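(* Let $B$ be a separable dual Banach space and $v: \mathbb{R}\times B\to B$ a Borel vector field. Let $(\mu_t)_{t\in \mathbb{R}}$ be a narrowly continuous curve in $\mathscr{P}(B)$ such that $$t\in \mathbb{R}\mapsto \int_{B}\Vert v(t,u) \Vert \,\mu_t(du) \in L^1_{loc}(\mathbb{R},dt).$$ Assume that the initial value problem $\dot\gamma(t)=v(t,\gamma(t))$, $\gamma(t_0)=x$, admits a measurable flow $(\phi_{t_0}^t)$ with respect to $(\mu_t)_{t\in \mathbb{R}}$. Then the curve $(\mu_t)_{t\in \mathbb{R}}$ satisfies the statistical Liouville equation with respect to $v$.
   Context: Separable dual Banach space: a real separable Banach space $(B,\|\cdot\|)$ for which there is a real Banach space $(E,\|\cdot\|_E)$ with $B=E^*$ and $\|\cdot\|=\|\cdot\|_{E^*}$. $\langle\cdot,\cdot\rangle$ denotes the duality bracket between $B=E^*$ and $E$. Global mild solution of $\dot\gamma(t)=v(t,\gamma(t))$, $\gamma(t_0)=x$: a curve $\gamma\in\mathscr{C}(\mathbb{R};B)$ such that $v(\cdot,\gamma(\cdot))\in L^1_{loc}(\mathbb{R},dt;B)$ and $\gamma(t)=x+\int_{t_0}^t v(s,\gamma(s))\,ds$ for all $t\in\mathbb{R}$ (Bochner integral). Fixed biorthogonal system: families $\{e_k\}_{k\in\mathbb{N}}\subset E$, $\{e_k^*\}_{k\in\mathbb{N}}\subset B$ are fixed such that $\mathrm{Span}\{e_k\}$ is dense in $E$, $\mathrm{Span}\{e_k^*\}$ is dense in $B$, and $\langle e^*_{k'},e_k\rangle=\delta_{k',k}$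 (such a system always exists; if $B$ is finite-dimensional, the index set is finite and the families are a basis of $E$ and its dual basis). $\mathscr{C}^\infty_{c,cyl}(B)$ is the set of functions $F(u)=\varphi(\langle u,e_1\rangle,\dots,\langle u,e_n\rangle)$ with $n\in\mathbb{N}$ and $\varphi\in\mathscr{C}_c^\infty(\mathbb{R}^n)$; for such $F$, $\nabla F(u)=\sum_{k=1}^n\partial_k\varphi(\langle u,e_1\rangle,\dots,\langle u,e_n\rangle)\,e_k\in E$. $\mathscr{P}(B)$ is the set of Borel probability measures on $(B,\|\cdot\|)$. A curve $(\mu_t)_{t\in \mathbb{R}}$ in $\mathscr{P}(B)$ is narrowly continuous if $t\mapsto\int_B F\,d\mu_t$ is continuous for every bounded continuous $F:(B,\|\cdot\|)\to\mathbb{R}$. It satisfies the statistical Liouville equation with respect to $v$ if $$\frac{d}{dt}\int_B F(u)\,\mu_t(du)=\int_B\langle v(t,u),\nabla F(u)\rangle\,\mu_t(du)\qquad\forall F\in\mathscr{C}^\infty_{c,cyl}(B)$$ in the sense of distributions on $\mathbb{R}$. Measurable flow: the initial value problem admits a measurable flow $\phi_{t_0}^t$ with respect to a narrowly continuous curve $(\mu_t)_{t\in\mathbb{R}}$ in $\mathscr{P}(B)$ if for all $t_0\in\mathbb{R}$ the sets $$\mathscr{G}_{t_0}=\{x\in B:\exists!\,\gamma_x\text{ a global mild solution such that }\gamma_x(t_0)=x\}$$ are Borel sets with $\mu_{t_0}(\mathscr{G}_{t_0})=1$, and the maps $\phi_{t_0}^t:\mathscr{G}_{t_0}\to\mathscr{G}_t$,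 $x\mapsto\gamma_x(t)$, are Borel measurable and satisfy for all $s,t,t_0\in\mathbb{R}$: $\phi_{t_0}^{t_0}=\mathrm{Id}$; $\phi_s^t\circ\phi_{t_0}^s=\phi_{t_0}^t$; $t\in\mathbb{R}\mapsto\phi_{t_0}^t(x)\in B$ is continuous for any $x\in\mathscr{G}_{t_0}$; $\mu_t=(\phi_{t_0}^t)_\sharp\mu_{t_0}$. *)

(* Defs.v *)
From mathcomp Require Import all_boot all_order all_algebra.
From mathcomp Require Import all_classical all_reals all_analysis.
Import Order.TTheory GRing.Theory Num.Theory.
Import numFieldNormedType.Exports.

Set Implicit Arguments.
Unset Strict Implicit.
Unset Printing Implicit Defensive.

Local Open Scope classical_set_scope.
Local Open Scope ring_scope.

Definition separable_space (T : topologicalType) : Prop :=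
  exists D : set T, countable D /\ dense D.

(* [borel T] is the carrier [T] equipped with the sigma-algebra generated by
   its open sets. *)
Notation borel T := (g_sigma_algebraType (@open T)).

(* [br] exhibits [B] as the normed dual [E^*]: [u |-> br u] is a linear
   isometry of [B] onto the space of continuous linear forms on [E] with the
   operator norm. *)
Definition dual_pairing (R : realType) (B E : completeNormedModType R)
    (br : B -> E -> R) : Prop :=
  [/\ forall u : B, linear (br u : E -> R^o) /\
                    continuous (br u : E -> R^o),
      forall x : E, linear (fun u : B => br u x : R^o),
      forall u : B, `|u| = sup [set `|br u x| | x in [set x : E | `|x| <= 1]]
    & forall f : E -> R^o, linear f -> continuous f ->
        exists u : B, forall x : E, br u x = f x].

(* The linear span of the family [(f k)_(k in K)]; this form is adequate because
   [K] is always an initial segment of [nat] below. *)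
Definition lin_span (R : realType) (V : normedModType R) (K : set nat)
    (f : nat -> V) : set V :=
  [set x | exists n : nat, `I_n `<=` K /\
           exists c : 'I_n -> R, x = \sum_(k < n) c k *: f k].

(* The index set is all of [nat], or finite when [B] is finite-dimensional;
   indices start at 0. *)
Definition biorthogonal_system (R : realType) (B E : completeNormedModType R)
    (br : B -> E -> R) (K : set nat) (e : nat -> E) (es : nat -> B) : Prop :=
  [/\ K = setT \/ (exists d : nat, K = `I_d),
      dense (lin_span K e),
      dense (lin_span K es)
    & forall k' k : nat, K k' -> K k -> br (es k') (e k) = (k' == k)%:R].

(* Bochner integral over [D] as the limit of integrals of simple functions
   converging in the mean; on a separable space Borel measurability and strong
   measurability coincide. *)
Section Bochner.
Context (d : measure_display) (T : measurableType d) (R : realType).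
Context (B : completeNormedModType R) (mu : {measure set T -> \bar R}).

Definition simple_function (s : T -> B) : Prop :=
  finite_set (range s) /\ forall y : B, measurable (s @^-1` [set y]).

Definition simple_integral (D : set T) (s : T -> B) : B :=
  \sum_(y \in range s) fine (mu (D `&` s @^-1` [set y])) *: y.

Definition is_bochner_integral (D : set T) (f : T -> B) (I : B) : Prop :=
  measurable_fun D (f : T -> borel B) /\
  exists s : nat -> T -> B,
    [/\ forall n, simple_function (s n) /\
                  mu.-integrable D (fun t => `|s n t|%:E),
        (\int[mu]_(t in D) `|f t - s n t|%:E)%E @[n --> \oo] --> 0%E
      & simple_integral D (s n) @[n --> \oo] --> I].

End Bochner.

Section Liouville.
Context (R : realType) (B E : completeNormedModType R).

Local Notation leb := (@lebesgue_measure R).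

Definition is_oriented_integral (f : R -> B) (a b : R) (I : B) : Prop :=
  if a <= b then is_bochner_integral leb `[a, b] f I
  else is_bochner_integral leb `[b, a] f (- I).

Definition locally_bochner_integrable (f : R -> B) : Prop :=
  measurable_fun setT (f : measurableTypeR R -> borel B) /\
  locally_integrable setT (fun t => `|f t|).

Definition borel_vector_field (v : R -> B -> B) : Prop :=
  measurable_fun setT
    ((fun z : R * B => v z.1 z.2) : borel (R * B)%type -> borel B).

Definition mild_solution (v : R -> B -> B) (t0 : R) (x : B) (g : R -> B)
    : Prop :=
  [/\ continuous g,
      locally_bochner_integrable (fun s => v s (g s))
    & forall t : R, is_oriented_integral (fun s => v s (g s)) t0 t (g t - x)].

Definition uniquely_solvable (v : R -> B -> B) (t0 : R) : set (borel B) :=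
  [set x | exists! g : R -> B, mild_solution v t0 x g].

Definition narrowly_continuous (mu : R -> probability (borel B) R) : Prop :=
  forall F : B -> R, continuous F -> (exists M : R, forall u, `|F u| <= M) ->
    continuous (fun t : R => \int[mu t]_u F u).

(* [phi t0 t x] is the value at time [t] of the solution equal to [x] at time
   [t0]; it is only constrained for [x] in [uniquely_solvable v t0]. *)
Record measurable_flow (v : R -> B -> B) (mu : R -> probability (borel B) R)
    (phi : R -> R -> B -> B) : Prop := MeasurableFlow {
  flow_borel : forall t0, measurable (uniquely_solvable v t0) ;
  flow_full : forall t0, mu t0 (uniquely_solvable v t0) = 1%E ;
  flow_solution : forall t0 x, uniquely_solvable v t0 x ->
    mild_solution v t0 x (fun t => phi t0 t x) ;
  flow_codomain : forall t0 t x, uniquely_solvable v t0 x ->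
    uniquely_solvable v t (phi t0 t x) ;
  flow_measurable : forall t0 t,
    measurable_fun (uniquely_solvable v t0)
      (phi t0 t : borel B -> borel B) ;
  flow_id : forall t0 x, uniquely_solvable v t0 x -> phi t0 t0 x = x ;
  flow_comp : forall t0 s t x, uniquely_solvable v t0 x ->
    phi s t (phi t0 s x) = phi t0 t x ;
  flow_continuous : forall t0 x, uniquely_solvable v t0 x ->
    continuous (fun t => phi t0 t x) ;
  flow_pushforward : forall t0 t (A : set (borel B)), measurable A ->
    mu t A = mu t0 (uniquely_solvable v t0 `&` phi t0 t @^-1` A)
}.

Definition compactly_supported (T : topologicalType) (f : T -> R) : Prop :=
  compact (closure [set x | f x != 0]).

Definition partial n (k : 'I_n) (f : 'rV[R]_n -> R) : 'rV[R]_n -> R :=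
  'D_(delta_mx 0 k : 'rV[R]_n) (f : 'rV[R]_n -> R^o).

Fixpoint Ck n (k : nat) (f : 'rV[R]_n -> R) : Prop :=
  continuous f /\
  if k is k'.+1 then
    forall i : 'I_n,
      (forall x, derivable (f : 'rV[R]_n -> R^o) x (delta_mx 0 i)) /\
      Ck k' (partial i f)
  else True.

Definition smooth_compact n (f : 'rV[R]_n -> R) : Prop :=
  (forall k, Ck k f) /\ compactly_supported f.

Definition test_function (psi : R -> R) : Prop :=
  (forall (k : nat) (x : R), derivable (derive1n k psi : R -> R^o) x 1) /\
  compactly_supported psi.

(* [f' = g] in the sense of distributions on the real line; [g] is required to
   be locally integrable, so that it defines a distribution. *)
Definition distributional_derivative (f g : R -> R) : Prop :=
  [/\ locally_integrable setT f, locally_integrable setT g &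
      forall psi : R -> R, test_function psi ->
        \int[leb]_t (f t * derive1 psi t) = - \int[leb]_t (g t * psi t)].

Section Cylindrical.
Context (br : B -> E -> R) (e : nat -> E).

Definition coordinates n (u : B) : 'rV[R]_n := \row_(k < n) br u (e k).

Definition cyl n (f : 'rV[R]_n -> R) (u : B) : R := f (coordinates n u).

Definition cyl_grad n (f : 'rV[R]_n -> R) (u : B) : E :=
  \sum_(k < n) partial k f (coordinates n u) *: e k.

(* The integrability clause makes the real-valued integral of
   [<v(t, .), grad F>] meaningful for almost every [t]. *)
Definition statistical_Liouville (K : set nat) (v : R -> B -> B)
    (mu : R -> probability (borel B) R) : Prop :=
  forall (n : nat) (f : 'rV[R]_n -> R), `I_n `<=` K -> smooth_compact f ->
    {ae leb, forall t, (mu t).-integrable setT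
       (fun u => (br (v t u) (cyl_grad f u))%:E)} /\
    distributional_derivative
      (fun t => \int[mu t]_u cyl f u)
      (fun t => \int[mu t]_u br (v t u) (cyl_grad f u)).

End Cylindrical.
End Liouville.

(* Main.v *)
Require Import Defs.
From HB Require Import structures.
From mathcomp Require Import all_boot all_order all_algebra.
From mathcomp Require Import all_classical all_reals all_analysis.
From mathcomp Require Import measurable_realfun ring lra.
Import Order.TTheory GRing.Theory Num.Theory.
Import numFieldNormedType.Exports.
Local Open Scope classical_set_scope.
Local Open Scope ring_scope.

(** Fix a cylindrical function [F] and a test function [psi] supported in
    [- T, T], and start the flow at time [- T].  Since [mu t] is the law of
    [phi (- T) t] under [mu (- T)], both integrals over [B] become integrals
    over initial data, and after exchanging the order of integration it is
    enough to prove, for each solution [g] of the differential equation,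

      [\int (F (g t) * psi' t + <v(t, g t), grad F (g t)> * psi t) dt = 0].

    The integrand is the almost everywhere derivative of [psi t * F (g t)],
    which vanishes at both ends of [- T, T].  So the theorem is a chain rule
    for solutions, a product rule and Fubini's theorem.

    - Chain rule.  Continuous linear forms commute with the Bochner integral
      ([bochner_integral_functional]), hence the coordinates of a solution are
      primitives of the integrable coordinates of its velocity.  The chain rule
      ([primitive_on_chain]) and the product rule ([primitive_on_mul]) are then
      needed for primitives of functions that are merely integrable.  Both come
      from [primitive_on_sum]: if near every time [c] the increments of [b]
      agree with [\sum_i p_i c * \int w_i] up to an arbitrarily small multiple
      of [\sum_i \int |w_i|], then [b] is a primitive of [\sum_i p_i * w_i].

    - Measurability.  Fubini's theorem requires [v(t, phi (- T) t x)] to be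
      jointly measurable in [t] and [x].  The flow is continuous in [t] and
      measurable in [x]; so is the pair [(t, phi (- T) t x)], and such functions
      are jointly measurable ([measurable_Caratheodory]) as pointwise limits of
      functions that are piecewise constant in time.

    - Integrability.  [|<v, grad F>| <= C |v|], and the integral of [|v|]
      along the flow is that of [|v(t, .)|] against [mu t], which is locally
      integrable in time by assumption ([integrable_along_flow]). *)

Set Implicit Arguments.
Unset Strict Implicit.
Unset Printing Implicit Defensive.

(** * Primitives of integrable functions *)

Section AbsolutelyContinuous.
Context {R : realType}.
Local Notation leb := (@lebesgue_measure R).
Implicit Types (a b c s t : R) (f g p w : R -> R).

(** A continuous induction: the supremum of the times [t] at which
    [|D t - D a| <= e * (m t - m a)] can be passed as long as it is below [b],
    so this bound holds at [b] for every [e]. *)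
Lemma locally_small_increments_eq (D m : R -> R) a b : a <= b ->
  (forall e c, 0 < e -> a <= c <= b -> exists2 d, 0 < d &
     forall s t, a <= s -> t <= b -> c - d < s <= c -> c <= t < c + d ->
       `|D t - D s| <= e * (m t - m s)) ->
  D b = D a.
Proof.
move=> ab Dm.
have H e : 0 < e -> `|D b - D a| <= e * (m b - m a).
  move=> e0.
  pose S := [set t | a <= t <= b /\ `|D t - D a| <= e * (m t - m a)].
  have Sa : S a by split; [rewrite lexx ab|rewrite !subrr normr0 mulr0].
  have ubS : ubound S b by move=> t [/andP[]].
  have supS : has_sup S by split; [exists a|exists b].
  have ac : a <= sup S by apply: ub_le_sup => //; exists b.
  have cb : sup S <= b by apply: ge_sup => //; exists a.
  have [d d0 Hd] := Dm _ (sup S) e0 (introT andP (conj ac cb)).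
  have [s [/andP[as_ sb] Ss] cds] := sup_adherent d0 supS.
  have sc : s <= sup S by apply: ub_le_sup; [exists b|split; rewrite ?as_].
  have step t : sup S <= t < sup S + d -> t <= b -> S t.
    move=> /andP[ct td] tb; split; first by rewrite (le_trans ac ct).
    have := Hd s t as_ tb; rewrite cds sc ct td => /(_ erefl erefl) Hst.
    rewrite (_ : D t - D a = (D t - D s) + (D s - D a)); last by ring.
    by rewrite (le_trans (ler_normD _ _))//; lra.
  have [bc|cb'] := leP b (sup S + d / 2).
    by have [] // := step b _ _; rewrite ?cb//=; lra.
  have : sup S + d / 2 <= sup S.
    by apply: ub_le_sup; [exists b|apply: step; lra].
  by lra.
apply/eqP; rewrite -subr_eq0 -normr_le0; apply/ler_addgt0Pl => e e0.
rewrite addr0; pose M := `|m b - m a| + 1.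
have M0 : 0 < M by rewrite ltr_pwDr.
apply: le_trans (H (e / M) _) _; first by rewrite divr_gt0.
rewrite mulrAC ler_pdivrMr// ler_wpM2l ?(ltW e0)//.
by rewrite (le_trans (ler_norm _))// lerDl.
Qed.

Lemma Rintegral_itv_split f a b s t : leb.-integrable `[a, b] (EFin \o f) ->
  a <= s -> s <= t -> t <= b ->
  \int[leb]_(x in `[a, t]) f x - \int[leb]_(x in `[a, s]) f x =
  \int[leb]_(x in `[s, t]) f x.
Proof.
move=> intf as_ st tb.
have intat : leb.-integrable `[a, t] (EFin \o f).
  by apply: integrableS intf => //; apply: subset_itvl; rewrite bnd_simp.
rewrite Rintegral_itvB ?bnd_simp// Rintegral_itv_obnd_cbnd//.
by apply: integrableS intat => //; apply: subset_itvr; rewrite bnd_simp.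
Qed.

Lemma integrable_subitv (f : R -> \bar R) a b s t :
  leb.-integrable `[a, b] f -> a <= s -> t <= b -> leb.-integrable `[s, t] f.
Proof.
by move=> intf as_ tb; apply: integrableS intf => //; apply: subset_itv;
   rewrite bnd_simp.
Qed.

Lemma integrable_sum_Rintegral d (T : measurableType d)
    (mu : {measure set T -> \bar R}) (D : set T) (I : Type) (r : seq I)
    (h : I -> T -> R) :
  measurable D -> (forall i, mu.-integrable D (EFin \o h i)) ->
  mu.-integrable D (fun x => (\sum_(i <- r) h i x)%:E) /\
  \int[mu]_(x in D) (\sum_(i <- r) h i x) =
    \sum_(i <- r) \int[mu]_(x in D) h i x.
Proof.
move=> mD ih.
have ih' : mu.-integrable D (fun x => (\sum_(i <- r) h i x)%:E).
  rewrite (_ : (fun x => _) = fun x => (\sum_(i <- r) (EFin \o h i) x)%E).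
    by apply: integrable_sum => // i _; exact: ih.
  by apply/funext => x; rewrite sumEFin.
split => //; rewrite /Rintegral.
under eq_integral do rewrite -sumEFin.
rewrite integral_sum// -sum_fine// => i _.
by apply: integrable_fin_num => //; exact: ih.
Qed.

(** Absolute continuity of [g] on [a, b], with almost everywhere derivative [w],
    in the integral form in which the mild formulation provides it. *)
Definition primitive_on a b g w :=
  leb.-integrable `[a, b] (EFin \o w) /\
  forall s t, a <= s -> s <= t -> t <= b ->
    g t - g s = \int[leb]_(x in `[s, t]) w x.

Lemma integrableM_continuous p w a b : continuous p ->
  leb.-integrable `[a, b] (EFin \o w) ->
  leb.-integrable `[a, b] (EFin \o (fun x => p x * w x)).
Proof.
move=> cp iw.
have bp : [bounded p x | x in `[a, b]%classic].
  have : compact [set p x | x in `[a, b]%classic].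
    apply: continuous_compact; last exact: segment_compact.
    exact: continuous_subspaceT.
  move=> /compact_bounded [M [Mr HM]]; exists M; split=> // N MN x abx.
  by apply: HM => //; exists x.
apply: (@integrableMr _ _ _ leb _ (measurable_itv `[a, b]) p (EFin \o w)) =>
  //=.
apply: (@measurable_funTS _ _ (measurableTypeR R) (measurableTypeR R)).
exact: continuous_measurable_fun.
Qed.

(** The continuity of the coefficients lets [p i c] replace [p i x] under the
    integral over a short interval around [c]; then the increments of the
    difference of the two sides are small compared with those of
    [\sum_i \int |w i|], and [locally_small_increments_eq] applies. *)
Lemma primitive_on_sum n a b (p w : 'I_n -> R -> R) g :
  (forall i, leb.-integrable `[a, b] (EFin \o w i)) ->
  (forall i, continuous (p i)) ->
  (forall e c, 0 < e -> a <= c <= b -> exists2 d, 0 < d &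
     forall s t, a <= s -> t <= b -> c - d < s <= c -> c <= t < c + d ->
       `|g t - g s - \sum_(i < n) p i c * \int[leb]_(x in `[s, t]) w i x|
         <= e * \sum_(i < n) \int[leb]_(x in `[s, t]) `|w i x|) ->
  primitive_on a b g (fun t => \sum_(i < n) p i t * w i t).
Proof.
move=> iw cp Hg.
have ipw i := integrableM_continuous (cp i) (iw i).
have [ih _] := @integrable_sum_Rintegral _ _ leb _ _ (index_enum _) _
  (measurable_itv `[a, b]) ipw.
split => // s0 t0 as0 st0 tb0.
pose h x := \sum_(i < n) p i x * w i x.
pose D t := g t - \int[leb]_(x in `[s0, t]) h x.
pose m t := \sum_(i < n) \int[leb]_(x in `[s0, t]) `|w i x|.
have inti := fun (f : R -> \bar R) i => @integrable_subitv f _ _ _ _ i as0 tb0.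
suff : D t0 = D s0.
  rewrite /D set_itv1 Rintegral_set1 subr0 => /eqP.
  by rewrite subr_eq addrC -subr_eq => /eqP.
apply: (@locally_small_increments_eq D m) => // e c e0 /andP[sc ct].
have e20 : 0 < e / 2 by rewrite divr_gt0.
have [|d d0 Hd] := Hg _ c e20; first by lra.
have [d' d'0 Hd'] : exists2 d', 0 < d' &
    forall x i, `|x - c| < d' -> `|p i x - p i c| <= e / 2.
  have near_i i : \forall x \near nbhs c, `|p i x - p i c| <= e / 2.
    have /cvgrPdist_le /(_ _ e20) := cp i c.
    by apply: filterS => x; rewrite distrC.
  have /nbhs_ballP[d' /= d'0 Hd'] :
      nbhs c (fun x => forall i, `|p i x - p i c| <= e / 2).
    exact: filter_forall near_i.
  exists d' => // x i xd.
  by apply: Hd'; rewrite /ball/= distrC.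
exists (Num.min d d'); first by rewrite lt_min d0.
move=> s t s0s tt0 /andP[cds sc'] /andP[ct' tcd].
move: cds tcd; rewrite ltrBlDr -ltrBlDl lt_min => /andP[cds1 cds2].
rewrite -ltrBlDl lt_min => /andP[tcd1 tcd2].
have st : s <= t by lra.
have imt := fun (f : R -> \bar R) i =>
  @integrable_subitv f _ _ _ _ (inti f i) s0s tt0.
have ih' := inti _ ih; rewrite -/h in ih'.
rewrite /D /m -sumrB.
rewrite (_ : \sum_(i < n) _ = \sum_(i < n) \int[leb]_(x in `[s, t]) `|w i x|);
  last first.
  by apply: eq_bigr => i _; rewrite (@Rintegral_itv_split _ s0 t0)//;
    apply/integrable_norm/inti/iw.
rewrite (_ : _ - _ - _ = g t - g s - \int[leb]_(x in `[s, t]) h x); last first.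
  by rewrite -(@Rintegral_itv_split h s0 t0 s t)//; ring.
have -> : \int[leb]_(x in `[s, t]) h x =
   \sum_(i < n) \int[leb]_(x in `[s, t]) (p i x * w i x).
  by apply: (@integrable_sum_Rintegral _ _ leb _ _ (index_enum _)
    (fun i x => p i x * w i x) _ _).2 => // i; exact/imt/ipw.
pose L := \sum_(i < n) p i c * \int[leb]_(x in `[s, t]) w i x.
rewrite (_ : _ - _ - _ = (g t - g s - L) +
    (L - \sum_(i < n) \int[leb]_(x in `[s, t]) (p i x * w i x))); last by ring.
rewrite (le_trans (ler_normD _ _))// [e in leRHS](splitr e) mulrDl lerD//.
  by apply: Hd; rewrite ?(le_trans as0)// ?(le_trans tt0)//; lra.
rewrite /L -sumrB (le_trans (ler_norm_sum _ _ _))// mulr_sumr ler_sum// => i _.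
have iwi := imt _ (iw i).
have ipwi := imt _ (ipw i).
have ipc : leb.-integrable `[s, t] (EFin \o (fun x => p i c * w i x)).
  exact: (@integrableM_continuous (fun=> p i c)) (@cst_continuous _ _ _) iwi.
rewrite -RintegralZl// -RintegralB//.
have -> : \int[leb]_(x in `[s, t]) (p i c * w i x - p i x * w i x) =
          \int[leb]_(x in `[s, t]) ((p i c - p i x) * w i x).
  by apply: eq_Rintegral => x _; ring.
have iD : leb.-integrable `[s, t] (EFin \o (fun x => (p i c - p i x) * w i x)).
  apply: integrableM_continuous => // x.
  by apply: cvgB; [exact: cvg_cst|exact: cp].
apply: (le_trans (le_normr_Rintegral _ _)) => //.
rewrite -RintegralZl//; last exact: integrable_norm.
apply: le_Rintegral => //; first exact: integrable_norm.
  exact: (@integrableM_continuous (fun=> e / 2)) (@cst_continuous _ _ _)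
    (integrable_norm iwi).
move=> x /=; rewrite in_itv/= => /andP[sx xt].
rewrite normrM ler_wpM2r// distrC Hd'//.
by rewrite ltr_norml; lra.
Qed.
End AbsolutelyContinuous.

Lemma primitive_on_base {R : realType} (a b : R) (g w : R -> R) :
  (@lebesgue_measure R).-integrable `[a, b] (EFin \o w) ->
  (forall t, a <= t -> t <= b ->
    g t - g a = \int[@lebesgue_measure R]_(x in `[a, t]) w x) ->
  primitive_on a b g w.
Proof.
move=> iw gw; split=> // s t as_ st tb.
rewrite -(Rintegral_itv_split iw as_ st tb) -!gw//; last 2 first.
- exact: le_trans st tb.
- exact: le_trans as_ st.
by ring.
Qed.

(** * Chain and product rules *)

Section ChainRule.
Context {R : realType}.
Local Notation leb := (@lebesgue_measure R).

(** The difference quotient of [f] along the line is that of the directional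
    derivative, term by term. *)
Lemma is_derive_line n (f : 'rV[R]_n -> R) (z : 'rV[R]_n) (k : 'I_n) (r : R) :
  derivable (f : 'rV[R]_n -> R^o) (z + r *: delta_mx 0 k) (delta_mx 0 k) ->
  is_derive r 1 (fun t : R => f (z + t *: delta_mx 0 k) : R^o)
    (partial k f (z + r *: delta_mx 0 k)).
Proof.
move=> df; pose u : 'rV[R]_n := delta_mx 0 k.
have E : (fun h : R => h^-1 *: ((fun t : R => f (z + t *: u) : R^o) (h *: 1 + r)
           - f (z + r *: u))) =
         (fun h : R => h^-1 *: ((f : 'rV[R]_n -> R^o) (h *: u + (z + r *: u))
           - f (z + r *: u))).
  apply/funext => h; congr (_ *: (f _ - _)).
  by rewrite [h *: 1]mulr1 scalerDl addrCA.
apply: DeriveDef; first by rewrite /derivable /= E.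
by rewrite /derive /partial /= E.
Qed.

(** The two bounds on [r] place it between [0] and [c], whatever the sign of
    [c]. *)
Lemma partial_mvt n (f : 'rV[R]_n -> R) (z : 'rV[R]_n) (k : 'I_n) (c : R) :
  (forall x, derivable (f : 'rV[R]_n -> R^o) x (delta_mx 0 k)) ->
  exists2 r : R, `|r| <= `|c| /\ `|c - r| <= `|c| &
    f (z + c *: delta_mx 0 k) - f z = partial k f (z + r *: delta_mx 0 k) * c.
Proof.
move=> df; pose g t : R^o := f (z + t *: delta_mx 0 k).
have dg (t : R) : is_derive t (1 : R) g (partial k f (z + t *: delta_mx 0 k)).
  exact: is_derive_line.
have cg (A : set R) : {within A, continuous g}.
  apply: continuous_subspaceT => t.
  by apply/differentiable_continuous/derivable1_diffP; case: (dg t).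
have g0 : g 0 = f z by rewrite /g scale0r addr0.
have [c0|/ltW c0] := leP 0 c.
  have [r] := MVT_segment c0 (fun t _ => dg t) (cg _).
  rewrite in_itv/= subr0 g0 => /andP[r0 rc] E; exists r => //.
  by rewrite !ger0_norm ?subr_ge0//; split=> //; lra.
have [r] := MVT_segment c0 (fun t _ => dg t) (cg _).
rewrite in_itv/= sub0r g0 => /andP[r0 rc] E; exists r.
  by rewrite !ler0_norm ?subr_le0//; split; lra.
by rewrite -/(g c) -opprB E mulrN opprK.
Qed.

(** A first-order expansion with a remainder controlled coordinate by
    coordinate: going from [x] to [y] along the axes stays in the box, and each
    step is a mean value theorem in one variable.  This replaces the Frechet
    differentiability of functions with continuous partial derivatives. *)
Lemma C1_increment n (f : 'rV[R]_n -> R) (p x y : 'rV[R]_n) (r e : R) :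
  (forall k z, derivable (f : 'rV[R]_n -> R^o) z (delta_mx 0 k)) ->
  (forall k z, ball p r z -> `|partial k f z - partial k f p| <= e) ->
  ball p r x -> ball p r y ->
  `|f y - f x - \sum_(k < n) partial k f p * (y 0 k - x 0 k)|
    <= e * \sum_(k < n) `|y 0 k - x 0 k|.
Proof.
move=> df close px py.
(* The corners of the path along the axes from [x] to [y]. *)
pose z (j : nat) : 'rV[R]_n := \row_k (if (k < j)%N then y 0 k else x 0 k).
have -> : f y - f x = \sum_(k < n) (f (z k.+1) - f (z k)).
  rewrite -(big_mkord xpredT (fun k => f (z k.+1) - f (z k))).
  rewrite telescope_sumr//; congr (f _ - f _); apply/rowP => k; rewrite mxE//.
  by rewrite ltn_ord.
rewrite -sumrB (le_trans (ler_norm_sum _ _ _))// mulr_sumr ler_sum// => k _.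
have zS : z k.+1 = z k + (y 0 k - x 0 k) *: delta_mx 0 k.
  apply/rowP => i; rewrite !mxE ltnS leq_eqVlt.
  have [->|ik] := eqVneq i k; first by rewrite eqxx ltnn eqxx mulr1 addrC subrK.
  by rewrite (negbTE (_ : nat_of_ord i != k))//= mulr0 addr0.
have [c [c1 c2]] := partial_mvt (z k) (y 0 k - x 0 k) (df k).
rewrite -zS => ->; rewrite -mulrBl normrM ler_wpM2r// close//.
have [r0 {}px] := px; have [_ {}py] := py; split=> // i j.
rewrite !mxE (ord1 i) eqxx/=.
have [->|jk] := eqVneq j k; last first.
  by rewrite mulr0 addr0; case: ifP => _; [exact: py|exact: px].
rewrite ltnn mulr1.
have := px 0 k; have := py 0 k.
rewrite /ball/= !ltr_norml => /andP[? ?] /andP[? ?].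
apply/andP; have [d0|d0] := leP 0 (y 0 k - x 0 k).
  rewrite (ger0_norm d0) !ler_norml in c1 c2.
  by move/andP: c1 => [? ?]; move/andP: c2 => [? ?]; split; lra.
rewrite (ltr0_norm d0) !ler_norml in c1 c2.
by move/andP: c1 => [? ?]; move/andP: c2 => [? ?]; split; lra.
Qed.

Lemma primitive_on_chain n (f : 'rV[R]_n -> R) (A : R -> 'rV[R]_n)
    (w : 'I_n -> R -> R) (a b : R) :
  (forall k z, derivable (f : 'rV[R]_n -> R^o) z (delta_mx 0 k)) ->
  (forall k, continuous (partial k f)) ->
  continuous A ->
  (forall k, primitive_on a b (fun t => A t 0 k) (w k)) ->
  primitive_on a b (fun t => f (A t))
    (fun t => \sum_(k < n) partial k f (A t) * w k t).
Proof.
move=> df cf cA Aw.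
apply: (@primitive_on_sum _ n a b (fun k t => partial k f (A t)) w).
- by move=> k; case: (Aw k).
- by move=> k t; apply: continuous_comp; [exact: cA|exact: cf].
move=> e c e0 /andP[ac cb].
have near_k k : \forall z \near nbhs (A c),
    `|partial k f z - partial k f (A c)| <= e.
  have /cvgrPdist_le /(_ _ e0) := cf k (A c).
  by apply: filterS => z; rewrite distrC.
have /nbhs_ballP[r /= r0 Hr] : nbhs (A c) (fun z => forall k,
    `|partial k f z - partial k f (A c)| <= e) by exact: filter_forall near_k.
have /nbhs_ballP[d /= d0 Hd] : nbhs c (A @^-1` ball (A c) r).
  by apply: cA; exact: nbhsx_ballx.
exists d => // s t as_ tb /andP[cds sc] /andP[ct tcd].
have st : s <= t by lra.
have incr k : \int[leb]_(x in `[s, t]) w k x = A t 0 k - A s 0 k.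
  by case: (Aw k) => _ ->.
under eq_bigr do rewrite incr.
apply: (@le_trans _ _ (e * \sum_(k < n) `|A t 0 k - A s 0 k|)).
  apply: (@C1_increment _ f (A c) _ _ r).
  - by [].
  - by move=> k z /Hr.
  - by apply: Hd; rewrite /ball/= ltr_norml; lra.
  - by apply: Hd; rewrite /ball/= ltr_norml; lra.
rewrite ler_wpM2l ?(ltW e0)// ler_sum// => k _.
rewrite -incr; apply: le_normr_Rintegral => //.
by case: (Aw k) => iw _; exact: (@integrable_subitv _ _ a b).
Qed.

Lemma primitive_on_mul (g h w u : R -> R) (a b : R) :
  continuous g -> continuous h ->
  primitive_on a b g w -> primitive_on a b h u ->
  primitive_on a b (fun t => h t * g t) (fun t => h t * w t + g t * u t).
Proof.
move=> cg ch [iw gw] [iu hu].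
pose p (i : 'I_2) := if i == 0 then h else g.
pose v (i : 'I_2) := if i == 0 then w else u.
have -> : (fun t => h t * w t + g t * u t) =
    (fun t => \sum_(i < 2) p i t * v i t).
  by apply/funext => t; rewrite big_ord_recl big_ord1.
apply: primitive_on_sum.
- by move=> i; rewrite /v; case: ifP.
- by move=> i; rewrite /p; case: ifP.
move=> e c e0 /andP[ac cb].
(* The defect of the bilinear expansion at [c] is
   [(h t - h c) (g t - g s) + (g s - g c) (h t - h s)]. *)
have /nbhs_ballP[d /= d0 Hd] : nbhs c (fun t =>
    `|h c - h t| <= e /\ `|g c - g t| <= e).
  apply: filterI.
  - by have /cvgrPdist_le /(_ _ e0) := ch c.
  - by have /cvgrPdist_le /(_ _ e0) := cg c.
exists d => // s t as_ tb /andP[cds sc] /andP[ct tcd].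
have st : s <= t by lra.
have [_ gs] : `|h c - h s| <= e /\ `|g c - g s| <= e.
  by apply: Hd; rewrite /ball/= ltr_norml; lra.
have [ht _] : `|h c - h t| <= e /\ `|g c - g t| <= e.
  by apply: Hd; rewrite /ball/= ltr_norml; lra.
rewrite !big_ord_recl !big_ord0 /p /v/= !addr0 -gw// -hu//.
have wle : `|g t - g s| <= \int[leb]_(x in `[s, t]) `|w x|.
  rewrite gw//; apply: le_normr_Rintegral => //.
  exact: integrable_subitv iw _ _.
have ule : `|h t - h s| <= \int[leb]_(x in `[s, t]) `|u x|.
  rewrite hu//; apply: le_normr_Rintegral => //.
  exact: integrable_subitv iu _ _.
rewrite (_ : _ - _ = (h t - h c) * (g t - g s) + (g s - g c) * (h t - h s));
  last by ring.
rewrite (le_trans (ler_normD _ _))// [leRHS]mulrDr !normrM lerD// ler_pM//.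
- by rewrite distrC.
- by rewrite distrC.
Qed.

Lemma primitive_on_C1 (psi : R -> R) (a b : R) :
  (forall x : R, derivable (psi : R -> R^o) x 1) ->
  continuous (derive1 psi) ->
  primitive_on a b psi (derive1 psi).
Proof.
move=> dpsi cdpsi.
have cpsi : continuous psi.
  by move=> x; apply/differentiable_continuous/derivable1_diffP.
split.
  apply: continuous_compact_integrable; first exact: segment_compact.
  exact: continuous_subspaceT.
move=> s t as_; rewrite le_eqVlt => /predU1P[-> _|st tb].
  by rewrite set_itv1 Rintegral_set1 subrr.
rewrite /Rintegral (@continuous_FTC2 _ _ psi)//.
- exact: continuous_subspaceT.
- split=> [x _||]; first exact: dpsi.
  + by apply: cvg_at_right_filter; exact: cpsi.
  + by apply: cvg_at_left_filter; exact: cpsi.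
Qed.

End ChainRule.

(** * Duality pairing and Bochner integral *)

Section Pairing.
Context {R : realType} {B E : completeNormedModType R} {br : B -> E -> R}.
Hypothesis dbr : dual_pairing br.

Lemma dual_pairing_linearl x : linear (fun u : B => br u x : R^o).
Proof. by case: dbr. Qed.

Lemma dual_pairing_linearr u : linear (br u : E -> R^o).
Proof. by case: dbr => /(_ u)[]. Qed.

Definition pairl x : {linear B -> R^o} :=
  HB.pack (fun u : B => br u x : R^o)
    (GRing.isLinear.Build _ _ _ _ _ (dual_pairing_linearl x)).

Definition pairr u : {linear E -> R^o} :=
  HB.pack (br u : E -> R^o)
    (GRing.isLinear.Build _ _ _ _ _ (dual_pairing_linearr u)).

(** The norm of [u] is a supremum in the reals, which bounds the values only
    when they have an upper bound: this is where the continuity of [br u]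
    is used. *)
Lemma dual_pairing_le u x : `|br u x| <= `|u| * `|x|.
Proof.
have [lin _ nrm _] := dbr.
have [->|x0] := eqVneq x 0.
  by rewrite [br u 0](linear0 (pairr u)) !normr0 mulr0.
have nx0 : 0 < `|x| by rewrite normr_gt0.
have ub : has_ubound [set `|br u y| | y in [set y : E | `|y| <= 1]].
  have : bounded_near (pairr u) (nbhs (0 : E)).
    by apply/linear_bounded_continuous; case: (lin u).
  move=> /linear_boundedP /pinfty_ex_gt0 [M M0 HM].
  exists M => _ [y /= y1 <-]; apply: le_trans (HM y) _.
  by rewrite ler_piMr// ltW.
have : `|br u (`|x|^-1 *: x)| <= `|u|.
  rewrite nrm; apply: ub_le_sup => //; exists (`|x|^-1 *: x) => //=.
  by rewrite normrZ normfV normr_id mulVf// gt_eqF.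
rewrite [br u _](linearZ_LR (pairr u))/= normrZ normfV normr_id.
by rewrite ler_pdivrMl// mulrC.
Qed.

Lemma dual_pairing_continuous x : continuous (fun u : B => br u x).
Proof.
apply: (bounded_linear_continuous (f := pairl x)).
apply/linear_boundedP; near=> r => u /=.
rewrite (le_trans (dual_pairing_le u x))// mulrC ler_wpM2r//.
Unshelve. all: by end_near. Qed.

End Pairing.

Section BorelMaps.
Context {R : realType}.

Lemma continuous_borel_measurable (T U : ptopologicalType) (g : T -> U) :
  continuous g -> measurable_fun setT (g : borel T -> borel U).
Proof.
move=> /continuousP cg.
apply: (@measurability _ _ (borel T) (borel U) setT g (@open U) erefl).
move=> _ [A oA <-]; rewrite setTI; apply: sub_sigma_algebra; exact: cg.
Qed.

Lemma continuous_borel_measurableR (T : ptopologicalType) (g : T -> R) :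
  continuous g -> measurable_fun setT (g : borel T -> measurableTypeR R).
Proof.
move=> /continuousP cg; apply: (measurability _ (RGenOpens.measurableE R)).
move=> _ [A [x [y ->]] <-]; rewrite setTI; apply: sub_sigma_algebra; apply: cg.
exact: interval_open.
Qed.
End BorelMaps.

Section BochnerFunctional.
Context {R : realType} {B : completeNormedModType R}.
Context {d : measure_display} {T : measurableType d}.
Variables (mu : {measure set T -> \bar R}) (D : set T).
Hypotheses (mD : measurable D) (muD : (mu D < +oo)%E).

(** Freezing the value of a simple function turns any expression in [s t] into
    a finite sum of indicators; the same enumeration of the range serves for
    the sum that defines the integral of [s]. *)
Lemma simple_function_expand (s : T -> B) (F : B -> T -> R) :
  finite_set (range s) ->
  exists r : seq B, (forall t, F (s t) t =
    \sum_(y <- r) F y t * \1_(s @^-1` [set y]) t) /\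
   (forall (V : zmodType) (G : B -> V),
    \sum_(y \in range s) G y = \sum_(y <- r) G y).
Proof.
move=> fs; exists (finmap.enum_fset (fset_set (range s))); split; last first.
  by move=> V G; rewrite fsbig_finite.
move=> t.
have sr : s t \in finmap.enum_fset (fset_set (range s)).
  by rewrite [_ \in _]in_fset_set// inE; exists t.
rewrite (bigD1_seq _ sr)/= ?finmap.fset_uniq// indicE mem_set// mulr1.
rewrite big1 ?addr0// => y ys; rewrite indicE memNset ?mulr0// => /= sty.
by rewrite sty eqxx in ys.
Qed.

Lemma integral_simple_functional (L : {linear B -> R^o}) (s : T -> B) :
  simple_function s ->
  mu.-integrable D (fun t => (L (s t))%:E) /\
  \int[mu]_(t in D) L (s t) = L (simple_integral mu D s).
Proof.
move=> [fs ms].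
have [r [E sumr]] := simple_function_expand (fun y _ => L y) fs.
have i1 y : mu.-integrable D (EFin \o (fun t => \1_(s @^-1` [set y]) t)).
  apply: measurable_bounded_integrable => //.
  - by exact: measurable_indic.
  - exists 1; split; rewrite ?num_real// => x x1 t _ /=.
    by rewrite indicE; case: (_ \in _); rewrite ?normr1 ?normr0; lra.
have iL y : mu.-integrable D
    (EFin \o (fun t => L y * \1_(s @^-1` [set y]) t)).
  by apply: (integrableZl mD) (i1 y).
have [iS eS] := integrable_sum_Rintegral r mD iL.
split; first by apply: eq_integrable iS => // t _; rewrite E.
under eq_Rintegral do rewrite E.
rewrite eS /simple_integral sumr linear_sum.
apply: eq_bigr => y _; rewrite RintegralZl// linearZ_LR/=.
rewrite /Rintegral integral_indic//.
by rewrite mulrC setIC.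
Qed.

(** On each level set of [s] this is the distance of [f] to a constant, that is,
    a continuous real function of [f]. *)
Lemma measurable_norm_sub_simple (f s : T -> B) :
  measurable_fun D (f : T -> borel B) -> simple_function s ->
  measurable_fun D (fun t => `|f t - s t|).
Proof.
move=> mf [fs ms].
have [r [E _]] := simple_function_expand (fun y t => `|f t - y|) fs.
rewrite (funext E); apply: measurable_sum => y; apply: measurable_funM.
  apply: (@measurableT_comp _ _ _ _ (borel B) _ (fun u : B => `|u - y|)) => //.
  apply: continuous_borel_measurableR => u.
  by apply: cvg_norm; apply: cvgB; [exact: cvg_id|exact: cvg_cst].
exact: measurable_indic.
Qed.

(** The identity holds for simple functions, and both sides pass to the limit:
    the left one because [|L (f t) - L (s n t)| <= C * |f t - s n t|]. *)
Lemma bochner_integral_functional (L : {linear B -> R^o}) (C : R) (f : T -> B)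
    (I : B) :
  0 <= C -> (forall u, `|L u| <= C * `|u|) ->
  mu.-integrable D (fun t => (L (f t))%:E) ->
  is_bochner_integral mu D f I ->
  \int[mu]_(t in D) L (f t) = L I.
Proof.
move=> C0 LC iLf [mf [s [hs cvf cvI]]].
have cL : continuous L.
  apply: bounded_linear_continuous; apply/linear_boundedP; near=> r => u.
  by rewrite (le_trans (LC u))// ler_wpM2r.
have cv1 : \int[mu]_(t in D) L (s n t) @[n --> \oo] --> L I.
  rewrite (_ : (fun n => _) = fun n => L (simple_integral mu D (s n))).
    exact: (cvg_comp _ _ cvI (cL I)).
  by apply/funext => n; have [/(integral_simple_functional L)[]] := hs n.
apply: (cvg_unique _ _ cv1) => //.
apply/cvgrPdist_le => e e0.
have d0 : 0 < e / (C + 1) by rewrite divr_gt0// ltr_wpDl.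
have /fine_cvgP [finf /cvgr0_norm_le /(_ _ d0) small] := cvf.
near=> n.
have [sn _] := hs n.
have [iLs _] := integral_simple_functional L sn.
have mfs := measurable_norm_sub_simple mf sn.
have fint : (\int[mu]_(t in D) `|f t - s n t|%:E)%E \is a fin_num.
  by near: n.
have iD : mu.-integrable D (EFin \o (fun t => L (f t) - L (s n t))).
  exact: (integrableB mD iLf iLs).
rewrite -RintegralB// -lee_fin EFin_normr_Rintegral//.
apply: le_trans (le_abse_integral _ mD (measurable_int mu iD)) _.
apply: (@le_trans _ _ (\int[mu]_(t in D) (C%:E * `|f t - s n t|%:E))%E).
  apply: ge0_le_integral => //.
  - by apply: measurableT_comp => //; exact: (measurable_int mu iD).
  - by apply: measurable_funeM; exact/measurable_EFinP.
  - by move=> t _; rewrite -EFinM lee_fin -linearB.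
rewrite ge0_integralZl_EFin//; last exact/measurable_EFinP.
rewrite -[X in (_ * X)%E]fineK// -EFinM lee_fin.
apply: (@le_trans _ _ (C * (e / (C + 1)))).
  rewrite ler_wpM2l//; apply: le_trans (ler_norm _) _.
  by near: n.
by rewrite mulrCA ger_pMr// ler_pdivrMr ?mul1r ?lerDl// ltr_wpDl.
Unshelve. all: by end_near. Qed.

End BochnerFunctional.

(** * Joint measurability *)

Section Limit.
Context {R : realType} {d : measure_display} {T : measurableType d}.
Context {Y : pseudoPMetricType R}.

(** For [U] open, a limit lies in [U] exactly when, for some radius, the
    sequence eventually stays among the points whose ball of that radius is
    contained in [U]; the interior makes this set of points Borel, as balls of a
    pseudometric need not be open. *)
Lemma measurable_borel_limit (g_ : nat -> T -> Y) (g : T -> Y) :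
  (forall n, measurable_fun setT (g_ n : T -> borel Y)) ->
  (forall x, g_ n x @[n --> \oo] --> g x) ->
  measurable_fun setT (g : T -> borel Y).
Proof.
move=> mg cvg_g; apply: (@measurability _ _ T (borel Y) setT g (@open Y) erefl).
move=> _ [U oU <-]; rewrite setTI.
pose O m : set Y := [set u | ball u m.+1%:R^-1 `<=` U]°.
have -> : g @^-1` U = \bigcup_m \bigcup_N \bigcap_(n in [set n | (N <= n)%N])
    (g_ n @^-1` O m).
  apply/seteqP; split => x.
    move=> /= Ugx; have : nbhs (g x) U by exact: open_nbhs_nbhs.
    move=> /nbhs_ballP[e /= e0 eU].
    have e20 : 0 < e / 2 by rewrite divr_gt0.
    have [m hm] := filter_ex (near_infty_natSinv_lt (PosNum e20)).
    have Om u : ball (g x) (e / 2) u -> ball u m.+1%:R^-1 `<=` U.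
      move=> gu w uw; apply: eU; rewrite (splitr e).
      by apply: ball_triangle gu _; apply: le_ball uw; exact: ltW.
    have e40 : 0 < e / 2 / 2 by rewrite divr_gt0.
    have /(_ _ (nbhsx_ballx (g x) _ e40)) [N _ HN] := cvg_g x.
    exists m => //; exists N => // n Nn; rewrite /O /interior.
    apply/nbhs_ballP; exists (e / 2 / 2) => // u gnu; apply: Om.
    by rewrite (splitr (e / 2)); apply: ball_triangle gnu; exact: HN.
  move=> [m _ [N _ gO]].
  have m0 : 0 < m.+1%:R^-1 :> R by rewrite invr_gt0.
  have /(_ _ (nbhsx_ballx (g x) _ m0)) [N' _ HN] := cvg_g x.
  have /interior_subset /= := gO (maxn N N') (leq_maxl _ _).
  by apply; apply/ball_sym/HN => /=; exact: leq_maxr.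
apply: bigcupT_measurable => m; apply: bigcupT_measurable => N.
apply: bigcap_measurable; first by exists N => /=.
move=> n _; rewrite -[X in measurable X]setTI; apply: mg => //.
by apply: sub_sigma_algebra; exact: open_interior.
Qed.

End Limit.

Section Caratheodory.
Context {R : realType} {d : measure_display} {T : measurableType d}.
Context {Y : pseudoPMetricType R}.

(** Discretised time: countably many values, each taken on an interval. *)
Definition grid (n : nat) (t : R) : R :=
  (Num.floor (t * n.+1%:R))%:~R / n.+1%:R.

Lemma cvg_grid t : grid n t @[n --> \oo] --> t.
Proof.
apply/cvgrPdist_le => e e0; near=> n.
have n0 : 0 < n.+1%:R :> R by [].
have /andP[ge lt] := floor_itv (t * n.+1%:R).
have -> : t - grid n t =
    (t * n.+1%:R - (Num.floor (t * n.+1%:R))%:~R) / n.+1%:R.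
  by rewrite mulrBl mulfK// gt_eqF.
rewrite normrM (@ger0_norm _ n.+1%:R^-1) ?invr_ge0//.
rewrite ger0_norm ?subr_ge0//.
apply: (@le_trans _ _ n.+1%:R^-1).
  rewrite ler_piMl ?invr_ge0//; move: lt; rewrite intrD; lra.
by apply/ltW; near: n; exact: (near_infty_natSinv_lt (PosNum e0)).
Unshelve. all: by end_near. Qed.

Lemma measurable_grid_eq n (k : int) :
  measurable ([set t | Num.floor (t * n.+1%:R) = k] : set (measurableTypeR R)).
Proof.
have n0 : 0 < n.+1%:R :> R by [].
rewrite (_ : [set _ | _] =
  `[k%:~R / n.+1%:R, (k + 1)%:~R / n.+1%:R[%classic).
  exact: measurable_itv.
apply/seteqP; split => t /=; rewrite in_itv/= ler_pdivrMr// ltr_pdivlMr//.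
  by move=> <-; exact: floor_itv.
exact: floor_def.
Qed.

(** With time replaced by [grid n], the preimage of a Borel set is a countable
    union of measurable rectangles; then [n] tends to infinity. *)
Lemma measurable_Caratheodory (Psi : R -> T -> Y) :
  (forall x, continuous (Psi^~ x)) ->
  (forall t, measurable_fun setT (Psi t : T -> borel Y)) ->
  measurable_fun setT
    ((fun z => Psi z.1 z.2) : (measurableTypeR R * T)%type -> borel Y).
Proof.
move=> cPsi mPsi.
apply: (@measurable_borel_limit R _ (measurableTypeR R * T)%type Y
  (fun n (z : measurableTypeR R * T) =>
    Psi (grid n z.1) z.2)) => [n|z]; last first.
  by apply: (@cvg_comp _ _ _ (grid ^~ z.1) (Psi ^~ z.2) _ (nbhs z.1));
    [exact: cvg_grid|exact: cPsi].
move=> _ A mA; rewrite setTI.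
rewrite (_ : _ @^-1` A = \bigcup_(k : int)
    ([set t | Num.floor (t * n.+1%:R) = k] `*`
     (Psi (k%:~R / n.+1%:R) @^-1` A))).
  apply: countable_bigcupT_measurable => [|k]; first exact: countableP.
  apply: measurableX; first exact: measurable_grid_eq.
  by rewrite -[X in measurable X]setTI; exact: mPsi.
apply/seteqP; split => -[t x] /=; first by exists (Num.floor (t * n.+1%:R)).
by move=> [k _ [/= <-]].
Qed.
End Caratheodory.

(** The integral is by definition the difference of those of the positive and
    negative parts, so it depends measurably on the parameter even where it is
    infinite. *)
Lemma measurable_parametric_integral d1 d2 (T1 : measurableType d1)
    (T2 : measurableType d2) (R : realType)
    (m2 : {sigma_finite_measure set T2 -> \bar R}) (k : T1 * T2 -> \bar R) :
  measurable_fun setT k -> measurable_fun setT (fubini_F m2 k).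
Proof.
move=> mk; rewrite (_ : fubini_F m2 k = fubini_F m2 k^\+ \- fubini_F m2 k^\-)%E.
  apply: emeasurable_funB.
  - apply: measurable_fun_fubini_tonelli_F => //; exact: measurable_funepos.
  - apply: measurable_fun_fubini_tonelli_F => //; exact: measurable_funeneg.
apply/funext => x; rewrite /fubini_F [LHS]integralE.
by congr (_ - _)%E; apply: eq_integral => y _; rewrite ?funeposE ?funenegE.
Qed.

(** * Compactly supported functions *)

Section CompactSupport.
Context {R : realType}.

(** Outside its closed support a function vanishes on a neighbourhood; hence
    partial derivatives inherit the compact support. *)
Lemma derive_out_support (V : normedModType R) (f : V -> R) (x u : V) :
  ~ closure [set y | f y != 0] x -> 'D_u (f : V -> R^o) x = 0.
Proof.
move=> nx.
have near0 : \forall y \near nbhs x, f y = 0.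
  have : nbhs x (~` closure [set y | f y != 0]).
    apply: open_nbhs_nbhs; split=> //; apply: closed_openC.
    exact: closed_closure.
  apply: filterS => y ny; apply/eqP/negPn/negP => fy; apply: ny.
  exact: subset_closure.
by rewrite (near_eq_derive (g := cst 0))// derive_val.
Qed.

Lemma bounded_of_compact_support (T : topologicalType) (C : set T)
    (g : T -> R) :
  compact C -> continuous g -> (forall x, ~ C x -> g x = 0) ->
  exists2 M, 0 <= M & forall x, `|g x| <= M.
Proof.
move=> cC cg g0.
have /compact_bounded : compact (g @` C).
  by apply: continuous_compact => //; exact: continuous_subspaceT.
move=> /pinfty_ex_gt0 [M M0 HM]; exists M; first exact: ltW.
move=> x; have [Cx|nCx] := pselect (C x); first by apply: HM; exists x.
by rewrite g0// normr0 ltW.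
Qed.

Lemma compactly_supported0 (T : topologicalType) (g : T -> R) (x : T) :
  ~ closure [set y | g y != 0] x -> g x = 0.
Proof.
move=> nx; apply/eqP/negPn/negP => gx; apply: nx.
by apply: subset_closure.
Qed.

End CompactSupport.

(** The interval is chosen strictly larger than the support, so that [psi] also
    vanishes at its end points. *)
Lemma test_function_support {R : realType} (psi : R -> R) :
  test_function psi -> exists2 T, 0 < T &
    psi T = 0 /\ psi (- T) = 0 /\
    forall t, ~ `[- T, T]%classic t -> psi t = 0 /\ derive1 psi t = 0.
Proof.
move=> [_ /compact_bounded /pinfty_ex_gt0 [M M0 HM]].
have far t : M < `|t| -> ~ closure [set y | psi y != 0] t.
  by move=> Mt /HM /=; rewrite leNgt Mt.
exists (M + 1); first by rewrite addr_gt0.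
have MM : M < `|M + 1| by rewrite ger0_norm; lra.
split; first exact/compactly_supported0/far.
split; first by apply/compactly_supported0/far; rewrite normrN.
move=> t ht; have /far nt : M < `|t|.
  rewrite ltNge; apply/negP => tM; apply: ht.
  by rewrite /= in_itv/=; move: tM; rewrite ler_norml; lra.
split; first exact: compactly_supported0.
by rewrite derive1E; exact: derive_out_support.
Qed.

(** * The law of the flow *)

(* The join of the pointed and the pseudometric structure of a product, for
   which [(t, total_flow t x)] is a Caratheodory function. *)
HB.instance Definition _ (R : numDomainType) (T U : pseudoPMetricType R) :=
  PseudoMetric.on (T * U)%type.

Section FlowMeasure.
Context {R : realType} {B : completeNormedModType R}.
Context {v : R -> B -> B} {mu : R -> probability (borel B) R}.
Context {phi : R -> R -> B -> B}.
Hypotheses (bv : borel_vector_field v) (mf : measurable_flow v mu phi).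
Local Notation leb := (@lebesgue_measure R).
Variable t0 : R.
Local Notation G := (uniquely_solvable v t0).

(** The flow is extended by a constant outside the well-posed initial data, a
    set of full measure, so that measurability and change of variables can be
    stated on all of [B]. *)
Definition total_flow (t : R) : borel B -> borel B :=
  (phi t0 t : borel B -> borel B) \_ G.

Lemma total_flowE t x : G x -> total_flow t x = phi t0 t x.
Proof. by move=> Gx; rewrite /total_flow patchE mem_set. Qed.

Lemma total_flow_continuous x : continuous (fun t => total_flow t x : B).
Proof.
have [Gx|nGx] := pselect (G x).
  rewrite (_ : (fun t => _) = (fun t => phi t0 t x)).
    exact: (flow_continuous mf Gx).
  by apply/funext => t; rewrite total_flowE.
rewrite (_ : (fun t => _) = cst point); first exact: cst_continuous.
by apply/funext => t; rewrite /total_flow patchE memNset.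
Qed.

Lemma measurable_total_flow t : measurable_fun setT (total_flow t).
Proof.
apply/(measurable_restrictT _ (flow_borel mf t0)).
exact: flow_measurable mf t0 t.
Qed.

Lemma unsolvable_negligible : mu t0 (~` G) = 0%E.
Proof.
by rewrite probability_setC ?(flow_full mf) ?subee//; exact: flow_borel mf t0.
Qed.

Lemma total_flow_law t (A : set (borel B)) : measurable A ->
  mu t A = pushforward (mu t0) (total_flow t) A.
Proof.
move=> mA; rewrite (flow_pushforward mf t0)//.
have mG := flow_borel mf t0.
have mpre : measurable (total_flow t @^-1` A).
  by rewrite -[X in measurable X]setTI; exact: measurable_total_flow.
rewrite /pushforward (_ : G `&` _ = G `&` total_flow t @^-1` A); last first.
  by apply/seteqP; split => x [Gx] /=; rewrite ?total_flowE// -?total_flowE.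
rewrite [RHS](@measureDI _ _ _ (mu t0) _ G)// setIC.
rewrite [X in (X + _)%E](_ : _ = 0%E) ?add0e//.
apply: (@subset_measure0 _ _ _ _ _ (~` G)) => //.
- exact: measurableD.
- exact: measurableC.
- exact: unsolvable_negligible.
Qed.

(** The integral is by definition the difference of those of the positive and
    negative parts, and each is transported even when it is infinite. *)
Lemma integral_total_flow t (g : B -> \bar R) :
  measurable_fun setT (g : borel B -> \bar R) ->
  (\int[mu t]_u g u = \int[mu t0]_x g (total_flow t x))%E.
Proof.
move=> mg; have mphi := measurable_total_flow t.
have H (h : B -> \bar R) : measurable_fun setT (h : borel B -> \bar R) ->
    (forall u, 0 <= h u)%E ->
    (\int[mu t]_u h u = \int[mu t0]_x h (total_flow t x))%E.
  move=> mh h0; have := @ge0_integral_pushforward _ _ _ _ _ _ mphi (mu t0)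
    setT h measurableT mh (fun u _ => h0 u).
  rewrite preimage_setT => <-.
  by apply: eq_measure_integral => A mA _; exact: total_flow_law.
rewrite [LHS]integralE [RHS]integralE !H//; first last.
- exact: measurable_funepos.
- exact: measurable_funeneg.
by congr (_ - _)%E; apply: eq_integral => x _; rewrite ?funeposE ?funenegE.
Qed.

Local Notation RB := (measurableTypeR R * borel B)%type.

Lemma measurable_total_flow_joint :
  measurable_fun setT ((fun z => total_flow z.1 z.2) : RB -> borel B).
Proof.
apply: (@measurable_Caratheodory R _ (borel B) B (fun t x => total_flow t x)).
  exact: total_flow_continuous.
exact: measurable_total_flow.
Qed.

Lemma measurable_velocity_joint :
  measurable_fun setT ((fun z => v z.1 (total_flow z.1 z.2)) : RB -> borel B).
Proof.
(* The pair [(t, total_flow t x)] is itself a Caratheodory function with values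
   in [R * B], hence measurable for the Borel sets of the product space, the
   sigma-algebra for which [v] is measurable. *)
have mpair : measurable_fun setT
    ((fun z => (z.1, total_flow z.1 z.2)) : RB -> borel (R * B)%type).
  apply: (@measurable_Caratheodory R _ (borel B) (R * B)%type
    (fun t x => (t, total_flow t x : B))) => [x t|t].
    exact: (cvg_pair cvg_id (@total_flow_continuous x t)).
  have mpt : measurable_fun setT
      ((fun u : B => (t, u)) : borel B -> borel (R * B)%type).
    apply: continuous_borel_measurable => u.
    exact: (cvg_pair (cvg_cst t) cvg_id).
  exact: (measurableT_comp mpt (measurable_total_flow t)).
exact: (measurableT_comp bv mpair).
Qed.

Lemma measurable_velocity t : measurable_fun setT (v t : borel B -> borel B).
Proof.
have mpt : measurable_fun setT
    ((fun u : B => (t, u)) : borel B -> borel (R * B)%type).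
  apply: continuous_borel_measurable => u.
  exact: (cvg_pair (cvg_cst t) cvg_id).
exact: (measurableT_comp bv mpt).
Qed.

Lemma measurable_norm_velocity t :
  measurable_fun setT ((fun u => `|v t u|%:E) : borel B -> \bar R).
Proof.
apply/measurable_EFinP.
apply: (@measurableT_comp _ _ _ _ (borel B) _ (fun u : B => `|u|)).
  by apply: continuous_borel_measurableR; exact: norm_continuous.
exact: measurable_velocity.
Qed.

Hypothesis iv : forall C : set R, compact C ->
  leb.-integrable C (fun t => (\int[mu t]_u `|v t u|%:E)%E).

(** By Tonelli the integral of [|k|] is at most [C] times the integral over
    [a, b] of [1 + \int |v t u| d(mu t)], the inner integral being carried
    from [mu t0] to [mu t] by the flow. *)
Lemma integrable_along_flow (k : RB -> R) (C a b : R) :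
  0 <= C -> measurable_fun setT k ->
  (forall t x, `|k (t, x)| <= C * (1 + `|v t (total_flow t x)|)) ->
  (forall t x, ~ `[a, b]%classic t -> k (t, x) = 0) ->
  (leb \x mu t0)%E.-integrable setT (EFin \o k).
Proof.
move=> C0 mk kC k0.
have mab : measurable (`[a, b]%classic : set (measurableTypeR R)).
  exact: measurable_itv.
have mEk : measurable_fun setT (EFin \o k) by exact/measurable_EFinP.
have mabs : measurable_fun setT (fun z => `|(EFin \o k) z|%E).
  exact: measurableT_comp.
have mF : measurable_fun setT
    (fun t : measurableTypeR R => \int[mu t0]_x `|(EFin \o k) (t, x)|)%E.
  by apply: (measurable_fun_fubini_tonelli_F (m2 := mu t0) _ mabs) => z;
    exact: abse_ge0.
apply/(integrable12ltyP _ _ mEk).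
have -> : (\int[leb]_t \int[mu t0]_x `|(EFin \o k) (t, x)| =
           \int[leb]_(t in `[a, b]) \int[mu t0]_x `|(EFin \o k) (t, x)|)%E.
  rewrite [RHS]integral_mkcond; apply: eq_integral => t _.
  rewrite patchE; case: ifPn => // /negP tab; rewrite integral0_eq// => x _ /=.
  by rewrite k0 ?normr0// => tab'; apply: tab; rewrite inE.
have iN : leb.-integrable `[a, b]
    (fun t => C%:E * (1 + \int[mu t]_u `|v t u|%:E))%E.
  apply: integrableZl => //; apply: integrableD => //; last first.
    by apply: iv; exact: segment_compact.
  apply/integrableP; split; first exact: measurable_cst.
  rewrite integral_cst//= normr1 mul1e.
  by rewrite lebesgue_measure_itv/=; case: ifP => // _; rewrite ltry.
apply: le_lt_trans (_ : _ < +oo)%E; last first.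
  by case/integrableP: iN => _; exact.
apply: ge0_le_integral => //.
- by move=> t _; exact: integral_ge0.
- exact: measurable_funTS.
- by apply: measurableT_comp => //; case/integrableP: iN.
move=> t _; rewrite gee0_abs; last first.
  by rewrite mule_ge0// ?lee_fin// adde_ge0// integral_ge0.
rewrite (integral_total_flow t (measurable_norm_velocity t)).
have mvt : measurable_fun setT (fun x : borel B => `|v t (total_flow t x)|%:E).
  exact: (measurableT_comp (measurable_norm_velocity t)
    (measurable_total_flow t)).
have int1 : (\int[mu t0]_x (cst 1 x) = 1 :> \bar R)%E.
  by rewrite integral_cst// mul1e; exact: probability_setT.
rewrite -[X in (_ * (X + _))%E]int1 -ge0_integralD//.
rewrite -ge0_integralZl//; last 2 first.
- exact: emeasurable_funD.
- by move=> x _; rewrite adde_ge0.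
apply: ge0_le_integral => //.
- apply: measurableT_comp => //; apply/measurable_EFinP.
  exact: (measurable_fun_pair2 t mk).
- by apply: measurable_funeM; exact: emeasurable_funD.
- by move=> x _ /=; rewrite -EFinD -EFinM lee_fin.
Qed.

End FlowMeasure.

(** * Cylindrical functions along the flow *)

Section Cylinder.
Context {R : realType} {B E : completeNormedModType R} {br : B -> E -> R}.
Hypothesis dbr : dual_pairing br.
Variables (e : nat -> E) (n : nat) (f : 'rV[R]_n -> R).

Lemma coordinates_continuous : continuous (coordinates br e n : B -> 'rV[R]_n).
Proof.
move=> u; apply/cvg_ballP => r r0.
have near_k (k : 'I_n) :
    \forall w \near nbhs u, ball (br u (e k)) r (br w (e k)).
  have /cvg_ballP := @dual_pairing_continuous _ _ _ _ dbr (e k) u.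
  exact.
have : nbhs u (fun w => forall k : 'I_n, ball (br u (e k)) r (br w (e k))).
  exact: filter_forall near_k.
by apply: filterS => w wk; split=> // i j; rewrite !mxE.
Qed.

Hypothesis sf : smooth_compact f.

Lemma smooth_compact_continuous : continuous f.
Proof. by case: sf => /(_ 0)[]. Qed.

Lemma smooth_compact_derivable k z :
  derivable (f : 'rV[R]_n -> R^o) z (delta_mx 0 k).
Proof. by case: sf => /(_ 1)[_ /(_ k)[]]. Qed.

Lemma smooth_compact_partial_continuous k : continuous (partial k f).
Proof. by case: sf => /(_ 1)[_ /(_ k)[_ []]]. Qed.

Lemma smooth_compact_bounded : exists2 M, 0 <= M & forall z, `|f z| <= M.
Proof.
have [_ cf] := sf.
apply: (bounded_of_compact_support cf smooth_compact_continuous).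
exact: compactly_supported0.
Qed.

Lemma smooth_compact_partial_bounded k :
  exists2 M, 0 <= M & forall z, `|partial k f z| <= M.
Proof.
have [_ cf] := sf.
apply: (bounded_of_compact_support cf (@smooth_compact_partial_continuous k)).
by move=> z; exact: derive_out_support.
Qed.

Lemma cyl_continuous : continuous (cyl br e f).
Proof.
move=> u; apply: (@cvg_comp _ _ _ (coordinates br e n) f _
  (nbhs (coordinates br e n u))).
  exact: coordinates_continuous.
exact: smooth_compact_continuous.
Qed.

Lemma cyl_grad_bounded : exists2 C, 0 < C & forall u, `|cyl_grad br e f u| <= C.
Proof.
have /choice[M HM] k : exists M, forall z, `|partial k f z| <= M.
  by have [M _ HM] := smooth_compact_partial_bounded k; exists M.
exists (\sum_(k < n) `|M k| * `|e k| + 1).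
  by rewrite ltr_wpDl// sumr_ge0// => k _; rewrite mulr_ge0.
move=> u; rewrite (le_trans (ler_norm_sum _ _ _))// ler_wpDr// ler_sum// => k _.
by rewrite normrZ ler_wpM2r// (le_trans (HM k _))// ler_norm.
Qed.

Lemma pairing_cyl_gradE w u : br w (cyl_grad br e f u) =
  \sum_(k < n) partial k f (coordinates br e n u) * br w (e k).
Proof.
rewrite /cyl_grad [LHS](linear_sum (pairr dbr w)).
by apply: eq_bigr => k _; rewrite linearZ_LR.
Qed.

Section AlongFlow.
Context {v : R -> B -> B} {mu : R -> probability (borel B) R}.
Context {phi : R -> R -> B -> B}.
Hypotheses (bv : borel_vector_field v) (mf : measurable_flow v mu phi).
Local Notation leb := (@lebesgue_measure R).
Local Notation RB := (measurableTypeR R * borel B)%type.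

Definition velocity_pairing t u := br (v t u) (cyl_grad br e f u).
Local Notation H := velocity_pairing.
Local Notation Phi := (@total_flow R B v phi).

Lemma measurable_pairing d (T : measurableType d) (W U : T -> borel B) :
  measurable_fun setT W -> measurable_fun setT U ->
  measurable_fun setT (fun x => br (W x) (cyl_grad br e f (U x))).
Proof.
move=> mW mU; rewrite (funext (fun x => pairing_cyl_gradE (W x) (U x))).
apply: measurable_sum => k; apply: measurable_funM.
- have mp : measurable_fun setT
    ((fun u : B => partial k f (coordinates br e n u)) : borel B -> R).
    apply: continuous_borel_measurableR => u.
    apply: (@cvg_comp _ _ _ (coordinates br e n) (partial k f) _
      (nbhs (coordinates br e n u))); first exact: coordinates_continuous.
    exact: smooth_compact_partial_continuous.
  exact: (measurableT_comp mp mU).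
- have mp : measurable_fun setT ((fun u : B => br u (e k)) : borel B -> R).
    by apply: continuous_borel_measurableR; exact: dual_pairing_continuous.
  exact: (measurableT_comp mp mW).
Qed.

Lemma measurable_velocity_pairing t :
  measurable_fun setT (H t : borel B -> R).
Proof.
have := measurable_pairing (measurable_velocity bv t) (@measurable_id _ _ setT).
exact.
Qed.

Lemma measurable_velocity_pairing_joint t0 :
  measurable_fun setT ((fun z => H z.1 (Phi t0 z.1 z.2)) : RB -> R).
Proof.
exact: (measurable_pairing (measurable_velocity_joint bv mf t0)
  (measurable_total_flow_joint mf t0)).
Qed.

Lemma measurable_cyl : measurable_fun setT (cyl br e f : borel B -> R).
Proof. by apply: continuous_borel_measurableR; exact: cyl_continuous. Qed.

Lemma measurable_cyl_joint t0 :
  measurable_fun setT ((fun z => cyl br e f (Phi t0 z.1 z.2)) : RB -> R).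
Proof.
exact: (measurableT_comp measurable_cyl (measurable_total_flow_joint mf t0)).
Qed.

Lemma velocity_pairing_le C : (forall u, `|cyl_grad br e f u| <= C) ->
  forall t u, `|H t u| <= C * `|v t u|.
Proof.
move=> HC t u; rewrite (le_trans (dual_pairing_le dbr _ _))// mulrC.
by rewrite ler_wpM2r.
Qed.

(** The coordinates of a solution are primitives of those of its velocity,
    because the mild formulation may be tested against each [e k]; the chain
    rule applies to the curve they form. *)
Lemma cyl_along_solution t0 b x : uniquely_solvable v t0 x ->
  primitive_on t0 b (fun t => cyl br e f (Phi t0 t x))
    (fun t => H t (Phi t0 t x)).
Proof.
move=> Gx; have [cg [mg lg] eqg] := flow_solution mf Gx.
have -> : (fun t => cyl br e f (Phi t0 t x)) =
    (fun t => f (coordinates br e n (phi t0 t x))).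
  by apply/funext => t; rewrite total_flowE.
have -> : (fun t => H t (Phi t0 t x)) = (fun t => \sum_(k < n)
    partial k f (coordinates br e n (phi t0 t x)) *
    br (v t (phi t0 t x)) (e k)).
  by apply/funext => t; rewrite total_flowE// /velocity_pairing
    pairing_cyl_gradE.
apply: (primitive_on_chain (A := fun t => coordinates br e n (phi t0 t x))
  (w := fun k t => br (v t (phi t0 t x)) (e k))).
- exact: smooth_compact_derivable.
- exact: smooth_compact_partial_continuous.
- move=> t; apply: (@cvg_comp _ _ _ (fun t => phi t0 t x) (coordinates br e n) _
    (nbhs (phi t0 t x))); first exact: cg.
  exact: coordinates_continuous.
move=> k.
have iw b' : leb.-integrable `[t0, b']
    (EFin \o (fun t => br (v t (phi t0 t x)) (e k))).
  have mw : measurable_fun setT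
      (fun t : measurableTypeR R => br (v t (phi t0 t x)) (e k)).
    have mp : measurable_fun setT ((fun u : B => br u (e k)) : borel B -> R).
      by apply: continuous_borel_measurableR; exact: dual_pairing_continuous.
    exact: (measurableT_comp mp mg).
  have ig : leb.-integrable `[t0, b']
      (fun t => `|e k|%:E * `|v t (phi t0 t x)|%:E)%E.
    apply: integrableZl => //.
    have [mng _ /(_ `[t0, b']%classic) fin] := lg.
    apply/integrableP; split.
      by apply/measurable_EFinP; exact: measurable_funTS.
    exact: fin (@subsetT _ _) (@segment_compact _ _ _).
  apply: le_integrable ig => //.
    by apply/measurable_EFinP; exact: measurable_funTS.
  move=> t _; rewrite /= lee_fin (le_trans (dual_pairing_le dbr _ _))//.
  by rewrite mulrC ler_norm.
apply: primitive_on_base => // t t0t tb.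
have := eqg t; rewrite /is_oriented_integral t0t => bi.
have muD : (leb `[t0, t] < +oo)%E.
  by rewrite lebesgue_measure_itv/=; case: ifP => // _; rewrite ltry.
have := @bochner_integral_functional _ _ _ _ leb _ (measurable_itv `[t0, t]) muD
  (pairl dbr (e k)) `|e k| _ _ (normr_ge0 _) _ (iw t) bi.
move=> /= ->; last by move=> u; rewrite mulrC; exact: dual_pairing_le.
rewrite !mxE (flow_id mf Gx).
exact: (esym (linearB (pairl dbr (e k)) _ _)).
Qed.

End AlongFlow.
End Cylinder.

(** * The two sides of the Liouville equation *)

Section Liouville.
Context {R : realType} {B E : completeNormedModType R} {br : B -> E -> R}.
Context {v : R -> B -> B} {mu : R -> probability (borel B) R}.
Context {phi : R -> R -> B -> B}.
Hypotheses (dbr : dual_pairing br) (bv : borel_vector_field v).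
Hypotheses (nmu : narrowly_continuous mu) (mf : measurable_flow v mu phi).
Local Notation leb := (@lebesgue_measure R).
Hypothesis iv : forall C : set R, compact C ->
  leb.-integrable C (fun t => (\int[mu t]_u `|v t u|%:E)%E).
Variables (e : nat -> E) (n : nat) (f : 'rV[R]_n -> R).
Hypothesis sf : smooth_compact f.
Local Notation F := (cyl br e f).
Local Notation H := (velocity_pairing (br := br) e f (v := v)).
Local Notation N := (fun t => \int[mu t]_u `|v t u|%:E)%E.
Local Notation RB := (measurableTypeR R * borel B)%type.

Lemma integrable_velocity_pairing t : (N t < +oo)%E ->
  (mu t).-integrable setT (fun u => (H t u)%:E).
Proof.
move=> Nt; have [C C0 HC] := cyl_grad_bounded (br := br) e sf.
have iN : (mu t).-integrable setT (fun u => C%:E * `|v t u|%:E)%E.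
  apply: integrableZl => //; apply/integrableP; split.
    exact: measurable_norm_velocity.
  by under eq_integral do rewrite /= normr_id.
apply: le_integrable iN => //.
  by apply/measurable_EFinP; exact: measurable_velocity_pairing.
move=> u _; rewrite /= lee_fin (le_trans (velocity_pairing_le dbr HC t u))//.
exact: ler_norm.
Qed.

(** The mean speed [N] is integrable on each [- m, m], hence finite at almost
    every time. *)
Lemma ae_integrable_velocity_pairing :
  {ae leb, forall t, (mu t).-integrable setT (fun u => (H t u)%:E)}.
Proof.
have : {ae leb, forall t, forall m : nat,
    `[- m%:R, m%:R]%classic t -> N t \is a fin_num}.
  apply: ae_foralln => m.
  by apply: integrable_ae => //; apply: iv; exact: segment_compact.
apply: (@filterS _ _ (ae_filter_ringOfSetsType leb)) => t Nt.
apply: integrable_velocity_pairing.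
have /Nt : `[- (Num.truncn `|t|).+1%:R, (Num.truncn `|t|).+1%:R]%classic t.
  by rewrite /= in_itv/= -ler_norml ltW// truncnS_gt.
by move=> /fin_numPlt /andP[].
Qed.

Lemma locally_integrable_cyl :
  locally_integrable setT (fun t => \int[mu t]_u F u).
Proof.
have cF : continuous (fun t => \int[mu t]_u F u).
  apply: nmu; first exact: cyl_continuous.
  by have [M _ HM] := smooth_compact_bounded sf; exists M => u; exact: HM.
split; [exact: continuous_measurable_fun|exact: openT|move=> K _ cK].
have /integrableP[_] :=
  continuous_compact_integrable cK (continuous_subspaceT cF).
exact.
Qed.

(** Transported to time [0] by the flow, the integral is one over a fixed
    measure of a jointly measurable function. *)
Lemma measurable_integral_velocity_pairing :
  measurable_fun setT (fun t : measurableTypeR R => \int[mu t]_u H t u).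
Proof.
pose k (z : RB) := (H z.1 (@total_flow R B v phi 0 z.1 z.2))%:E.
have mk : measurable_fun setT k.
  apply/measurable_EFinP.
  exact: (measurable_velocity_pairing_joint dbr e sf bv mf 0).
rewrite (_ : (fun t => _) = fine \o fubini_F (mu 0) k); last first.
  apply/funext => t; rewrite /Rintegral/= (integral_total_flow mf 0)//.
  by apply/measurable_EFinP; exact: measurable_velocity_pairing.
apply: measurableT_comp => //.
exact: (@measurable_parametric_integral _ _ (measurableTypeR R) _ _ (mu 0) k
  mk).
Qed.

(** The bound by [C] times the mean speed holds at every time: where the mean
    speed is infinite it is trivial, [C] being positive. *)
Lemma locally_integrable_velocity_pairing :
  locally_integrable setT (fun t => \int[mu t]_u H t u).
Proof.
have mg := measurable_integral_velocity_pairing.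
split; [exact: mg|exact: openT|move=> K _ cK].
have [C C0 HC] := cyl_grad_bounded (br := br) e sf.
have mK := compact_measurable cK.
have iN : leb.-integrable K (fun t => C%:E * N t)%E.
  by apply: integrableZl => //; exact: iv.
have /integrableP[mN] := iN; apply: le_lt_trans.
apply: ge0_le_integral => //.
- apply/measurable_EFinP; apply: measurableT_comp => //.
  exact: measurable_funTS.
- exact: measurableT_comp.
move=> t _; rewrite gee0_abs; last first.
  by rewrite mule_ge0 ?lee_fin ?(ltW C0)// integral_ge0.
have [Nt|] := ltP (N t) +oo%E; last first.
  by rewrite leye_eq => /eqP ->; rewrite gt0_muley ?lte_fin// leey.
have iH := integrable_velocity_pairing Nt.
rewrite EFin_normr_Rintegral//.
apply: le_trans (le_abse_integral _ measurableT (measurable_int _ iH)) _.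
rewrite -ge0_integralZl_EFin ?(ltW C0)//; last exact: measurable_norm_velocity.
apply: ge0_le_integral => //.
- by apply: measurableT_comp => //; exact: measurable_int iH.
- by apply: measurable_funeM; exact: measurable_norm_velocity.
- by move=> u _; rewrite /= lee_fin; exact: velocity_pairing_le.
Qed.

Lemma Rintegral_scaled_total_flow (t0 t c : R) (g : B -> R) :
  (mu t).-integrable setT (fun u => (g u)%:E) ->
  ((\int[mu t]_u g u * c)%:E =
   \int[mu t0]_x (g (@total_flow R B v phi t0 t x) * c)%:E)%E.
Proof.
move=> ig; have mg := measurable_int _ ig.
rewrite -[RHS](integral_total_flow mf t0 t (g := fun u => (g u * c)%:E));
  last first.
  apply/measurable_EFinP; apply: measurable_funM => //; exact/measurable_EFinP.
rewrite -RintegralZr// /Rintegral fineK//; apply: integrable_fin_num => //.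
exact: (integrableZr measurableT c ig).
Qed.

(** Up to the sign, the two sides are the integrals over time and initial data
    of the two terms of the derivative of [psi t * F (Phi t x)]; integrating in
    time first, their sum vanishes for every well-posed [x]. *)
Lemma Liouville_identity (psi : R -> R) : test_function psi ->
  \int[leb]_t ((\int[mu t]_u F u) * derive1 psi t) =
  - \int[leb]_t ((\int[mu t]_u H t u) * psi t).
Proof.
move=> tpsi; have [T T0 [psiT [psiNT psi0]]] := test_function_support tpsi.
have [dpsi cspsi] := tpsi.
have dpsi0 := dpsi 0; have dpsi1 := dpsi 1.
have cpsi : continuous psi.
  by move=> t; apply/differentiable_continuous/derivable1_diffP; exact: dpsi0.
have cdpsi : continuous (derive1 psi).
  by move=> t; apply/differentiable_continuous/derivable1_diffP; exact: dpsi1.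
have supp_bounded (g : R -> R) : continuous g ->
    (forall t, ~ `[- T, T]%classic t -> g t = 0) ->
    exists2 M, 0 <= M & forall t, `|g t| <= M.
  move=> cg g0; apply: bounded_of_compact_support cg g0.
  exact: segment_compact.
have [M1 M10 HM1] := smooth_compact_bounded sf.
have [C C0 HC] := cyl_grad_bounded (br := br) e sf.
have [Mp Mp0 HMp] := supp_bounded _ cpsi (fun t nt => (psi0 t nt).1).
have [Md Md0 HMd] := supp_bounded _ cdpsi (fun t nt => (psi0 t nt).2).
pose Phi := @total_flow R B v phi (- T).
pose k1 (z : RB) := F (Phi z.1 z.2) * derive1 psi z.1.
pose k2 (z : RB) := H z.1 (Phi z.1 z.2) * psi z.1.
have mtime (g : R -> R) : continuous g ->
    measurable_fun setT (fun z : RB => g z.1).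
  move=> cg.
  exact: (measurableT_comp (continuous_measurable_fun cg) measurable_fst).
have mk1 : measurable_fun setT k1.
  exact: (measurable_funM (measurable_cyl_joint dbr e sf mf (- T))
    (mtime _ cdpsi)).
have mk2 : measurable_fun setT k2.
  exact: (measurable_funM
    (measurable_velocity_pairing_joint dbr e sf bv mf (- T)) (mtime _ cpsi)).
have ik1 : (leb \x mu (- T))%E.-integrable setT (EFin \o k1).
  apply: (integrable_along_flow bv mf iv (C := M1 * Md) (a := - T) (b := T)).
  - exact: mulr_ge0.
  - exact: mk1.
  - move=> t x; rewrite normrM (@le_trans _ _ (M1 * Md))//.
      by apply: ler_pM => //; exact: HM1.
    by rewrite ler_peMr ?mulr_ge0// lerDl.
  - by move=> t x nt; rewrite /k1/= (psi0 t nt).2 mulr0.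
have ik2 : (leb \x mu (- T))%E.-integrable setT (EFin \o k2).
  apply: (integrable_along_flow bv mf iv (C := C * Mp) (a := - T) (b := T)).
  - by rewrite mulr_ge0// ltW.
  - exact: mk2.
  - move=> t x; rewrite normrM/=.
    apply: (@le_trans _ _ (C * `|v t (Phi t x)| * Mp)).
      by rewrite ler_pM//; exact: velocity_pairing_le.
    rewrite mulrAC ler_wpM2l ?mulr_ge0 ?(ltW C0)//.
    by rewrite lerDr.
  - by move=> t x nt; rewrite /k2/= (psi0 t nt).1 mulr0.
have mH := measurable_integral_velocity_pairing.
have E1 : (\int[leb]_t ((\int[mu t]_u F u) * derive1 psi t)%:E =
    \int[leb \x mu (- T)]_z (k1 z)%:E)%E.
  rewrite -(integral12_prod_meas1 ik1); apply: eq_integral => t _.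
  rewrite /fubini_F/= (Rintegral_scaled_total_flow (- T))//.
  apply: measurable_bounded_integrable => //.
  - by rewrite ltey_eq fin_num_measure.
  - exact: measurable_cyl.
  - exists M1; split; rewrite ?num_real// => x M1x u _.
    by apply: le_trans (HM1 _) _; exact: ltW.
have E2 : (\int[leb]_t ((\int[mu t]_u H t u) * psi t)%:E =
    \int[leb \x mu (- T)]_z (k2 z)%:E)%E.
  rewrite -(integral12_prod_meas1 ik2); apply: ae_eq_integral => //.
  - apply/measurable_EFinP; apply: measurable_funM => //.
    exact: continuous_measurable_fun.
  - exact: (measurable_fubini_F ik2).
  have := ae_integrable_velocity_pairing.
  apply: (@filterS _ _ (ae_filter_ringOfSetsType leb)) => t it _.
  by rewrite /fubini_F/= (Rintegral_scaled_total_flow (- T)).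
(* Integrating over time first; the initial data that are not well-posed are
   negligible. *)
have E0 : (\int[leb \x mu (- T)]_z ((k1 z)%:E + (k2 z)%:E) = 0)%E.
  rewrite -(integral21_prod_meas1 (integrableD measurableT ik1 ik2)).
  rewrite (ae_eq_integral (cst 0%E)) ?integral0//.
    exact: (measurable_fubini_G (integrableD measurableT ik1 ik2)).
  exists (~` uniquely_solvable v (- T)); split.
  - by apply: measurableC; exact: (flow_borel mf (- T)).
  - exact: (unsolvable_negligible mf (- T)).
  move=> x /= nx Gx; apply: nx => _; rewrite /fubini_G/=.
  have pg := cyl_along_solution dbr e sf mf (t0 := - T) T Gx.
  have pp := primitive_on_C1 (- T) T dpsi0 cdpsi.
  have cg : continuous (fun t => F (Phi t x)).
    move=> t; apply: (@cvg_comp _ _ _ (fun t => Phi t x) F _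
      (nbhs (Phi t x : B))).
      exact: (@total_flow_continuous _ _ _ _ _ mf (- T) x t).
    exact: cyl_continuous.
  have [ihg incr] := primitive_on_mul cg cpsi pg pp.
  have TT : - T <= T by lra.
  have := incr _ _ (lexx _) TT (lexx _).
  rewrite psiT psiNT !mul0r subrr => /esym int0.
  transitivity (\int[leb]_(t in `[(- T)%R, T])
      (psi t * H t (Phi t x) + F (Phi t x) * derive1 psi t)%:E)%E.
    rewrite [RHS]integral_mkcond; apply: eq_integral => t _.
    rewrite patchE; case: ifPn => [_|/negP tT].
      by rewrite -EFinD /k1 /k2/= addrC mulrC.
    have /psi0[p0 d0] : ~ `[- T, T]%classic t.
      by move=> h; apply: tT; rewrite inE.
    by rewrite /k1 /k2/= p0 d0 !mulr0 adde0.
  rewrite -[LHS]fineK; last exact: integrable_fin_num ihg.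
  by rewrite -[fine _]/(\int[leb]_(t in _) _) int0.
apply/eqP; rewrite -subr_eq0 opprK /Rintegral E1 E2 -fineD; last 2 first.
- exact: integrable_fin_num ik1.
- exact: integrable_fin_num ik2.
by rewrite -(integralD measurableT ik1 ik2) E0.
Qed.

End Liouville.

Unset Implicit Arguments.

Theorem theorem1p13 (R : realType) (B E : completeNormedModType R)
    (br : B -> E -> R) (K : set nat) (e : nat -> E) (es : nat -> B)
    (v : R -> B -> B) (mu : R -> probability (borel B) R)
    (phi : R -> R -> B -> B) :
  separable_space B ->
  dual_pairing br ->
  biorthogonal_system br K e es ->
  borel_vector_field v ->
  narrowly_continuous mu ->
  (forall C : set R, compact C ->
     (@lebesgue_measure R).-integrable C
       (fun t => (\int[mu t]_u `|v t u|%:E)%E)) ->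
  measurable_flow v mu phi ->
  statistical_Liouville br e K v mu.
Proof.
move=> _ dbr _ bv nmu iv mf n f _ sf.
split; first exact: ae_integrable_velocity_pairing.
split.
- exact: locally_integrable_cyl.
- exact: (locally_integrable_velocity_pairing dbr bv mf).
- by move=> psi tpsi; exact: (Liouville_identity dbr bv mf).
Qed.
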